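(* Let $v\equiv 3\pmod 6$ with $v\ge 9$. Then there exists a $(v,3,2)$-BIBD that has an optimal weak nesting with $w=(7v+3)/6$; that is, it has a weak nesting $\phi:\mathcal{A}\to Y$ with $|Y|=(7v+3)/6$, and no weak nesting of a $(v,3,2)$-BIBD uses fewer points.
   Context: A $(v,k,\lambda)$-BIBD is a pair $(X,\mathcal{A})$ where $X$ is a set of $v$ points and $\mathcal{A}$ is a multiset of $k$-subsets of $X$ (blocks) such that every pair of distinct points lies in exactly $\lambda$ blocks. A partial $(w,k,\lambda)$-BIBD is defined in the same way on $w$ points, except that every pair lies in at most $\lambda$ blocks. Given a $(v,k,\lambda)$-BIBD $(X,\mathcal{A})$ and a set $Y\supseteq X$ with $|Y|=w$, a map $\phi:\mathcal{A}\to Y$ is a weak nesting if $\phi(A)\notin A$ for every block $A$ and the multiset $\{A\cup\{\phi(A)\}:A\in\mathcal{A}\}$ is a partial $(w,k+1,\lambda+1)$-BIBD on $Y$. A weak nesting is optimal if $w=|Y|$ is as small as possible. *)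

(* Defs.v *)
From mathcomp Require Import all_boot.
Set Implicit Arguments. Unset Strict Implicit. Unset Printing Implicit Defensive.

(* A design on the point set X (a subset of a finite type T): blocks form a
   multiset, represented as a sequence of subsets of T. *)

Definition is_BIBD (T : finType) (X : {set T}) (v k lam : nat)
    (A : seq {set T}) : Prop :=
  [/\ #|X| = v,
      (forall B, B \in A -> B \subset X /\ #|B| = k) &
      (forall x y, x \in X -> y \in X -> x != y ->
         count (fun B : {set T} => (x \in B) && (y \in B)) A = lam)].

Definition is_partial_BIBD (T : finType) (Y : {set T}) (w k lam : nat)
    (A : seq {set T}) : Prop :=
  [/\ #|Y| = w,
      (forall B, B \in A -> B \subset Y /\ #|B| = k) &
      (forall x y, x \in Y -> y \in Y -> x != y ->
         count (fun B : {set T} => (x \in B) && (y \in B)) A <= lam)].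

(* The nested blocks A u {phi(A)}; blocks are indexed by their position in
   the sequence A, so repeated blocks may receive different points. *)
Definition nested_blocks (T : finType) (A : seq {set T})
    (phi : 'I_(size A) -> T) : seq {set T} :=
  [seq phi i |: nth set0 A i | i <- enum 'I_(size A)].

Definition weak_nesting (T : finType) (X Y : {set T}) (w k lam : nat)
    (A : seq {set T}) (phi : 'I_(size A) -> T) : Prop :=
  [/\ X \subset Y,
      (forall i, phi i \in Y),
      (forall i, phi i \notin nth set0 A i) &
      is_partial_BIBD Y w k.+1 lam.+1 (nested_blocks phi)].

Arguments weak_nesting {T} X Y w k lam A phi.
Arguments nested_blocks {T} A phi.

(* Main.v *)
Require Import Defs.
From mathcomp Require Import all_boot all_algebra all_fingroup all_solvable zify.
Set Implicit Arguments. Unset Strict Implicit. Unset Printing Implicit Defensive.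
Import GRing.Theory.

(* Lower bound: a block nested inside X uses up three of the v(v-1)/2 pairs,
   so at least half of the v(v-1)/3 blocks are nested outside X; each new point
   takes at most v of these, as it meets every point of X at most three times.

   Existence: write v = 3m with m odd.  Let R be an abelian group of odd order
   n > 1 with an odd map K such that K, K + 1 and K - 1 are injective, let the
   h range over representatives of the nonzero elements of R up to sign, and
   let M be an abelian group of order m.  On the points R x M x Z/3 take, for
   all r in R, x, y in M, e in Z/3 and i = h or -h, the block
     (r + Ki - i, x, e), (r + Ki + i, y, e), (r, x + y, e + 1),
   nested with (r + Ki, x - y, e + 1) if i = h and with a new point
   (h, x - y) if i = -h.  Points with distinct R-components meet exactly twice
   in the blocks and at most once more in the nesting, and every new point
   meets every point at most three times.  Filling each {r} x M x Z/3 with a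
   solution for m, all sharing the same (m + 1)/2 new points, gives a solution
   for nm.  Taking R = Z/n with gcd(n, 6) = 1 and K = 2, and R = (Z/3)^2 with
   K(a, b) = (-b, a), every odd m is reached from m = 1 and m = 3. *)

(** * Nested systems over finite index types *)

(* The point sets are kept as separate types P (old) and N (new).  Asking for at
   most two blocks on each pair suffices: the number of blocks forces equality. *)
Record nested_system (m : nat) (P N I : finType)
    (b : I -> {set P}) (phi : I -> P + N) : Prop := NestedSystem {
  card_points : #|P| = 3 * m;
  card_new : 2 * #|N| = m.+1;
  card_index : #|I| = m * (3 * m).-1;
  card_block : forall i, #|b i| = 3;
  pair_le2 : forall x y, x != y ->
    \sum_i ((x \in b i) && (y \in b i)) <= 2;
  notin_block : forall i x, phi i = inl x -> x \notin b i;
  star_le1 : forall x y, x != y ->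
    \sum_i ((phi i == inl x) && (y \in b i))
    + \sum_i ((phi i == inl y) && (x \in b i)) <= 1;
  new_le3 : forall z x, \sum_i ((phi i == inr z) && (x \in b i)) <= 3
}.

Definition has_nested_system m :=
  exists (P N I : finType) (b : I -> {set P}) (phi : I -> P + N),
    nested_system m b phi.

(** * Counting and injectivity in abelian groups *)

(** Joint injectivity leaves at most one nonzero summand, and [C] is a necessary condition for it to
    exist. Each count of outer blocks becomes an injectivity check in this way. *)
Lemma leq_sum_pair (U Q1 Q2 : finType) (F : U -> Q1) (G : U -> Q2) x y (C : bool) :
  (forall u v, F u = F v -> G u = G v -> u = v) ->
  (forall u, F u = x -> G u = y -> C) ->
  \sum_u ((F u == x) && (G u == y)) <= C.
Proof.
move=> FGinj FGC; pose D := [pred u | (F u == x) && (G u == y)].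
have ->: \sum_u ((F u == x) && (G u == y)) = #|D|.
  by rewrite -sum1_card [RHS]big_mkcond; apply: eq_bigr => u _; rewrite inE; case: ifP.
have [u /andP[/eqP Fu /eqP Gu]|D0] := pickP D; last by rewrite eq_card0.
rewrite (FGC u Fu Gu); apply/card_le1_eqP => u1 u2 /andP[/eqP F1 /eqP G1] /andP[/eqP F2 /eqP G2].
by apply: FGinj; congruence.
Qed.

(** Both [d] and the order of [V] annihilate [x - y], hence so does their gcd, which is 1. *)
Lemma mulrn_coprime_inj (V : finZmodType) d : coprime d #|V| ->
  injective (fun x : V => x *+ d)%R.
Proof.
move=> co x y /= exy; apply: subr0_eq; set z := (x - y)%R.
have zd : (z *+ d = 0)%R by rewrite mulrnBl exy subrr.
have zV : (z *+ #|V| = 0)%R.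
  by rewrite -FinRing.zmodXgE -cardsT; apply: expg_cardG; rewrite inE.
have : (z *+ gcdn d #|V| = 0)%R.
  case: d {co exy} zd => [|d] zd; first by rewrite gcd0n.
  have [km kn E _] := egcdnP #|V| (ltn0Sn d).
  have : (z *+ (km * d.+1) = 0)%R by rewrite mulnC mulrnA zd mul0rn.
  by rewrite E mulrnDr mulnC mulrnA zV mul0rn add0r.
by rewrite (eqP co).
Qed.

Lemma sub_add_inj (V : zmodType) : injective (fun x : V => x *+ 2)%R ->
  injective (fun w : V * V => (w.1 - w.2, w.1 + w.2)%R).
Proof.
move=> V2 [a b] [c d] [E1 E2].
have ac : a = c.
  apply: V2 => /=; have := congr2 +%R E1 E2; rewrite addrACA [RHS]addrACA.
  by rewrite ![(- _ + _)%R]addrC !subrr !addr0 -!mulr2n.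
by move: E2; rewrite ac => /addrI ->.
Qed.

(** * Recursive step: the outer blocks *)

Section Step.
Variables (R M : finZmodType) (H : finType) (K : R -> R) (g : H -> R).
Hypothesis KN : {morph K : i / - i}%R.
Hypothesis K_inj : injective K.
Hypothesis KD_inj : injective (fun i => K i + i)%R.
Hypothesis KB_inj : injective (fun i => K i - i)%R.
Hypothesis R2_inj : injective (fun i : R => i *+ 2)%R.
Hypothesis M2_inj : injective (fun x : M => x *+ 2)%R.
Hypothesis g_inj : injective g.
Hypothesis gN : forall h k, g h <> (- g k)%R.
Hypothesis cardR : #|R| = (2 * #|H|).+1.

Lemma K0 : K 0%R = 0%R.
Proof. by apply: R2_inj; rewrite /= mul0rn mulr2n -{2}oppr0 KN subrr. Qed.

(** The element i of the block formula: [true] stands for i = h, [false] for i = -h. *)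
Definition half_sign (p : bool * H) : R := (if p.1 then g p.2 else - g p.2)%R.

Lemma half_sign_inj : injective half_sign.
Proof.
move=> [[] h] [[] k]; rewrite /half_sign /= => E.
- by rewrite (g_inj E).
- by case: (gN E).
- by case: (@gN k h).
- by rewrite (g_inj (oppr_inj E)).
Qed.

Lemma half_sign_neq0 p : half_sign p <> 0%R.
Proof.
have g0 h : g h <> 0%R by move=> E; apply: (@gN h h); rewrite E oppr0.
case: p => [[] h]; rewrite /half_sign /=; first exact: g0.
by move/eqP; rewrite oppr_eq0 => /eqP; apply: g0.
Qed.

(** The components are (r, e), then the sign with h, then (x, y). *)
Definition outer_index : finType := ((R * 'I_3) * (bool * H) * (M * M))%type.
Definition cell : finType := (R * (M * 'I_3))%type.

Definition level (x : cell) := x.2.2.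

(** Common shape of the four points of a nested block; a pair of them is governed by the difference
    of the two maps [a] and by the joint map of the two [b]. *)
Definition corner (a : R -> R) (b : M * M -> M) (c : 'I_3) (u : outer_index) : cell :=
  (u.1.1.1 + a (half_sign u.1.2), (b u.2, u.1.1.2 + c))%R.

Lemma level_corner a b c u : level (corner a b c u) = (u.1.1.2 + c)%R.
Proof. by []. Qed.

Lemma corner_sub a b c a' b' c' d u : (forall i, a i - a' i = d i)%R ->
  ((corner a b c u).1 - (corner a' b' c' u).1 = d (half_sign u.1.2))%R.
Proof. by move=> <-; rewrite /corner /= opprD addrACA subrr add0r. Qed.

(** The difference of the [R]-components depends on i alone and determines it, as [d] is injective.
    The [M]-components then give (x, y), and e and r follow by cancellation. *)
Lemma corner_inj2 a b c a' b' c' d : (forall i, a i - a' i = d i)%R ->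
  injective d -> injective (fun w => (b w, b' w)) ->
  forall u v, corner a b c u = corner a b c v ->
    corner a' b' c' u = corner a' b' c' v -> u = v.
Proof.
move=> aE d_inj b_inj u v E E'.
have sE : u.1.2 = v.1.2.
  by apply/half_sign_inj/d_inj; rewrite -!(corner_sub b c b' c' _ aE) E E'.
have wE : u.2 = v.2.
  by apply: b_inj; congr pair;
    [move: (congr1 (fun x : cell => x.2.1) E) | move: (congr1 (fun x : cell => x.2.1) E')].
have eE : u.1.1.2 = v.1.1.2 by move: (congr1 level E) => /addIr.
have rE : u.1.1.1 = v.1.1.1 by move: (congr1 fst E); rewrite /= sE => /addIr.
by case: u v sE wE rE eE {E E'} => [[[r e] s] w] [[[r' e'] s'] w'] /= -> -> -> ->.
Qed.

Definition corner1 := corner (fun i => K i - i)%R fst 0%R.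
Definition corner2 := corner (fun i => K i + i)%R snd 0%R.
Definition corner3 := corner (fun=> 0)%R (fun w => w.1 + w.2)%R 1%R.
Definition apex := corner K (fun w => w.1 - w.2)%R 1%R.

Lemma corner21_sub i : ((K i + i) - (K i - i) = i *+ 2)%R.
Proof. by rewrite opprB addrC addrA subrK mulr2n. Qed.
Lemma apex_corner1_sub i : (K i - (K i - i) = i)%R.
Proof. by rewrite opprB addrC subrK. Qed.
Lemma apex_corner2_sub i : (K i - (K i + i) = - i)%R.
Proof. by rewrite opprD addrA subrr add0r. Qed.

(** * Pairs of corners and pairs with the nested point *)

Lemma corners21 x y :
  \sum_u ((corner2 u == x) && (corner1 u == y)) <= (x.1 != y.1) && (level x == level y).
Proof.
apply: leq_sum_pair => [|u <- <-].
  by apply: corner_inj2 corner21_sub R2_inj _ => -[a b] [c d] [-> ->].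
rewrite !level_corner eqxx andbT -subr_eq0 (corner_sub _ _ _ _ _ corner21_sub); apply/eqP.
by rewrite -(mul0rn _ 2) => /R2_inj; apply: half_sign_neq0.
Qed.

Lemma corners13 x y :
  \sum_u ((corner1 u == x) && (corner3 u == y)) <= (x.1 != y.1) && (level y == level x + 1)%R.
Proof.
have E i : (K i - i - 0 = K i - i)%R by rewrite subr0.
apply: leq_sum_pair => [|u <- <-].
  by apply: corner_inj2 E KB_inj _ => -[a b] [c d] [ac]; rewrite ac => /addrI ->.
rewrite !level_corner addr0 eqxx andbT -subr_eq0 (corner_sub _ _ _ _ _ E); apply/eqP.
by move=> Z; apply: (@half_sign_neq0 u.1.2); apply: KB_inj; rewrite Z K0 subrr.
Qed.

Lemma corners23 x y :
  \sum_u ((corner2 u == x) && (corner3 u == y)) <= (x.1 != y.1) && (level y == level x + 1)%R.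
Proof.
have E i : (K i + i - 0 = K i + i)%R by rewrite subr0.
apply: leq_sum_pair => [|u <- <-].
  by apply: corner_inj2 E KD_inj _ => -[a b] [c d] [ac]; rewrite ac => /addIr ->.
rewrite !level_corner addr0 eqxx andbT -subr_eq0 (corner_sub _ _ _ _ _ E); apply/eqP.
by move=> Z; apply: (@half_sign_neq0 u.1.2); apply: KD_inj; rewrite Z K0 addr0.
Qed.

Lemma apex_corner1_inj : injective (fun w : M * M => (w.1 - w.2, w.1)%R).
Proof. by move=> [a b] [c d] [+ ac]; rewrite ac => /addrI /oppr_inj ->. Qed.
Lemma apex_corner2_inj : injective (fun w : M * M => (w.1 - w.2, w.2)%R).
Proof. by move=> [a b] [c d] [+ ac]; rewrite ac => /addIr ->. Qed.
(** At most one of d and -d satisfies each of these predicates; this is what limits a pair to one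
    nesting. *)
Definition in_half (d : R) := [exists h, d == g h].
Definition in_Khalf (d : R) := [exists h, d == K (g h)].

Lemma in_halfN d : in_half d -> in_half (- d)%R -> False.
Proof. by case/existsP=> h /eqP-> /existsP[k /eqP/esym]; apply: gN. Qed.

Lemma in_KhalfN d : in_Khalf d -> in_Khalf (- d)%R -> False.
Proof.
case/existsP=> h /eqP-> /existsP[k /eqP]; rewrite -KN => /K_inj/esym.
exact: gN.
Qed.

Lemma in_half0 : ~~ in_half 0%R.
Proof. by apply/negP=> h0; case: (in_halfN h0); rewrite oppr0. Qed.
Lemma in_Khalf0 : ~~ in_Khalf 0%R.
Proof. by apply/negP=> h0; case: (in_KhalfN h0); rewrite oppr0. Qed.

(** The sign is kept so that comparison with [(x, true)] selects only the blocks nested with an old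
    point. *)
Definition signed_apex u : cell * bool := (apex u, u.1.2.1).

Lemma apex_corner1 x y :
  \sum_u ((signed_apex u == (x, true)) && (corner1 u == y))
  <= in_half (x.1 - y.1)%R && (level x == level y + 1)%R.
Proof.
apply: leq_sum_pair => [u v /(congr1 fst) E|u [<- s] <-].
  exact: (corner_inj2 (u := u) (v := v)
    apex_corner1_sub (fun _ _ => id) apex_corner1_inj (E : apex u = apex v)).
rewrite !level_corner addr0 eqxx andbT (corner_sub _ _ _ _ _ apex_corner1_sub).
by apply/existsP; exists u.1.2.2; rewrite /half_sign s.
Qed.

(** The nested point minus this corner is -i, so the difference enters with the sign opposite to the
    case of [corner1]. *)
Lemma apex_corner2 x y :
  \sum_u ((signed_apex u == (x, true)) && (corner2 u == y))
  <= in_half (y.1 - x.1)%R && (level x == level y + 1)%R.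
Proof.
apply: leq_sum_pair => [u v /(congr1 fst) E|u [<- s] <-].
  exact: (corner_inj2 (u := u) (v := v)
    apex_corner2_sub oppr_inj apex_corner2_inj (E : apex u = apex v)).
rewrite !level_corner addr0 eqxx andbT -opprB (corner_sub _ _ _ _ _ apex_corner2_sub) opprK.
by apply/existsP; exists u.1.2.2; rewrite /half_sign s.
Qed.

Lemma apex_corner3 x y :
  \sum_u ((signed_apex u == (x, true)) && (corner3 u == y))
  <= in_Khalf (x.1 - y.1)%R && (level x == level y).
Proof.
have E i : (K i - 0 = K i)%R by rewrite subr0.
apply: leq_sum_pair => [u v /(congr1 fst) E'|u [<- s] <-].
  exact: (corner_inj2 (u := u) (v := v) E K_inj (sub_add_inj M2_inj) (E' : apex u = apex v)).
rewrite !level_corner eqxx andbT (corner_sub _ _ _ _ _ E).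
by apply/existsP; exists u.1.2.2; rewrite /half_sign s.
Qed.

Definition tag_new (u : outer_index) := (u.1.2, u.2.1 - u.2.2)%R.

(** The tag fixes i and x - y; with the [M]-component of the corner it yields (x, y), then e and
    r. *)
Lemma new_corner a b c z x : injective (fun w : M * M => (w.1 - w.2, b w)%R) ->
  \sum_u ((tag_new u == z) && (corner a b c u == x)) <= 1.
Proof.
move=> b_inj; apply: (@leq_sum_pair _ _ _ _ _ _ _ true) => // u v [sE wE] E.
have {}wE : u.2 = v.2.
  by apply: b_inj; rewrite wE; congr pair; move: (congr1 (fun x : cell => x.2.1) E).
have eE : u.1.1.2 = v.1.1.2 by move: (congr1 level E) => /addIr.
have rE : u.1.1.1 = v.1.1.1 by move: (congr1 fst E); rewrite /= sE => /addIr.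
by case: u v sE wE rE eE {E} => [[[r e] s] w] [[[r' e'] s'] w'] /= -> -> -> ->.
Qed.

Lemma corner12_neq u : corner1 u != corner2 u.
Proof.
apply/negP=> /eqP/(congr1 fst)/esym/eqP; rewrite -subr_eq0.
rewrite (corner_sub _ _ _ _ _ corner21_sub) -(mul0rn _ 2) => /eqP/R2_inj.
exact: half_sign_neq0.
Qed.

Lemma ord3D1 (e : 'I_3) : (e == e + 1)%R = false.
Proof. by case: e => [[|[|[|]]]] //=. Qed.

Lemma corner13_neq u : corner1 u != corner3 u.
Proof. by rewrite /corner1 /corner3 /corner !xpair_eqE !addr0 ord3D1 !andbF. Qed.
Lemma corner23_neq u : corner2 u != corner3 u.
Proof. by rewrite /corner2 /corner3 /corner !xpair_eqE !addr0 ord3D1 !andbF. Qed.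
Lemma corner1_apex_neq u : corner1 u != apex u.
Proof. by rewrite /corner1 /apex /corner !xpair_eqE !addr0 ord3D1 !andbF. Qed.
Lemma corner2_apex_neq u : corner2 u != apex u.
Proof. by rewrite /corner2 /apex /corner !xpair_eqE !addr0 ord3D1 !andbF. Qed.
Lemma corner3_apex_neq u : corner3 u != apex u.
Proof.
rewrite /corner3 /apex /corner !xpair_eqE negb_and addr0 eq_sym -subr_eq0 addrC addKr.
by apply/orP; left; apply/eqP; rewrite -(K0) => /K_inj; apply: half_sign_neq0.
Qed.

Definition outer_block u : {set cell} := [set corner1 u; corner2 u; corner3 u].

Lemma card_outer_block u : #|outer_block u| = 3.
Proof.
rewrite /outer_block -setUA !cardsU1 cards1 !inE.
by rewrite negb_or corner12_neq corner13_neq corner23_neq.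
Qed.

Lemma ord3_level (e f : 'I_3) :
  (e == f) + ((e == f + 1)%R + (f == e + 1)%R) = 1.
Proof. by case: e => [[|[|[|]]] //= ?]; case: f => [[|[|[|]]] //= ?]. Qed.

(** Points on equal levels can only be corners 1 and 2, in two orders. On different levels, the
    higher one (cyclically) is corner 3 and the other is corner 1 or 2. Either way two counts of at
    most one remain. *)
Lemma outer_pair x y : x != y ->
  \sum_u ((x \in outer_block u) && (y \in outer_block u)) <= 2 * (x.1 != y.1).
Proof.
move=> xy.
apply: (@leq_trans (\sum_u
   ((((corner2 u == x) && (corner1 u == y)) + ((corner2 u == y) && (corner1 u == x)))
   + (((corner1 u == x) && (corner3 u == y)) + ((corner1 u == y) && (corner3 u == x)))
   + (((corner2 u == x) && (corner3 u == y)) + ((corner2 u == y) && (corner3 u == x)))))).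
  apply: leq_sum => u _; rewrite !inE !(eq_sym x) !(eq_sym y).
  have ex q : ~~ ((q == x) && (q == y)).
    by apply/negP=> /andP[/eqP-> /eqP E]; rewrite E eqxx in xy.
  move: (ex (corner1 u)) (ex (corner2 u)) (ex (corner3 u)).
  by do 6!case: (_ == _) => //=.
rewrite !big_split /=.
move: (corners21 x y) (corners21 y x) (corners13 x y) (corners13 y x)
  (corners23 x y) (corners23 y x).
move: (ord3_level (level x) (level y)).
rewrite [y.1 == x.1]eq_sym [level y == level x]eq_sym.
by move: (x.1 == y.1) (level x == level y) (level x == (level y + 1)%R) (level y == (level x + 1)%R)
  => [] [] [] [] /=; lia.
Qed.

(** On equal levels the nested point is joined to corner 3, and the two orders need opposite
    differences in [in_Khalf]. On different levels only the higher point can be nested, and corners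
    1 and 2 need opposite differences in [in_half]. *)
Lemma outer_star x y : x != y ->
  \sum_u ((signed_apex u == (x, true)) && (y \in outer_block u))
  + \sum_u ((signed_apex u == (y, true)) && (x \in outer_block u)) <= (x.1 != y.1).
Proof.
have split3 a b : \sum_u ((signed_apex u == (a, true)) && (b \in outer_block u)) <=
    \sum_u ((signed_apex u == (a, true)) && (corner1 u == b))
    + \sum_u ((signed_apex u == (a, true)) && (corner2 u == b))
    + \sum_u ((signed_apex u == (a, true)) && (corner3 u == b)).
  rewrite -!big_split /=; apply: leq_sum => u _; rewrite !inE !(eq_sym b).
  by do 4!case: (_ == _).
move=> xy; move: (split3 x y) (split3 y x).
move: (apex_corner1 x y) (apex_corner2 x y) (apex_corner3 x y)
  (apex_corner1 y x) (apex_corner2 y x) (apex_corner3 y x).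
move: (ord3_level (level x) (level y)).
rewrite [level y == level x]eq_sym.
have := in_halfN (d := (x.1 - y.1)%R); have := in_KhalfN (d := (x.1 - y.1)%R).
rewrite opprB.
case: (eqVneq x.1 y.1) => [->|_].
  rewrite subrr (negbTE in_half0) (negbTE in_Khalf0) /=; lia.
move: (in_half (x.1 - y.1)%R) (in_half (y.1 - x.1)%R)
  (in_Khalf (x.1 - y.1)%R) (in_Khalf (y.1 - x.1)%R)
  (level x == level y) (level x == (level y + 1)%R) (level y == (level x + 1)%R)
  => [] [] [] [] [] [] [] //=; try lia; intros; exfalso; auto.
Qed.

Lemma outer_new z x :
  \sum_u ((tag_new u == z) && (x \in outer_block u)) <= 3.
Proof.
apply: (@leq_trans (\sum_u ((tag_new u == z) && (corner1 u == x))
    + \sum_u ((tag_new u == z) && (corner2 u == x))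
    + \sum_u ((tag_new u == z) && (corner3 u == x)))).
  rewrite -!big_split /=; apply: leq_sum => u _; rewrite !inE !(eq_sym x).
  by do 4!case: (_ == _).
have := new_corner (fun i => K i - i)%R 0%R z x apex_corner1_inj.
have := new_corner (fun i => K i + i)%R 0%R z x apex_corner2_inj.
have := new_corner (fun=> 0)%R 1%R z x (sub_add_inj M2_inj).
rewrite -/corner1 -/corner2 -/corner3; lia.
Qed.

(** * Recursive step: filling the copies *)

Lemma sum_fiber (I : finType) (r0 : R) (F : R -> I -> nat) :
  (forall r i, r != r0 -> F r i = 0) ->
  \sum_(ri : R * I) F ri.1 ri.2 = \sum_i F r0 i.
Proof.
move=> F0; rewrite -(pair_bigA _ F) (bigD1 r0) //= [X in _ + X]big1 ?addn0 // => r rr0.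
by rewrite big1 // => i _; apply: F0.
Qed.

(** Inner blocks cover only pairs with equal [R]-component and outer blocks only pairs with distinct
    ones, so the two bounds never add up. A shared new point meets x only within the copy containing
    x. *)
Lemma nested_step m : #|M| = m ->
  has_nested_system m -> has_nested_system (#|R| * m).
Proof.
move=> cardM [P0 [N0 [I0 [b0 [phi0 S0]]]]].
have [f f_bij] : exists f : M * 'I_3 -> P0, bijective f.
  have cardP : #|{: M * 'I_3}| = #|P0|.
    by rewrite card_prod card_ord cardM (card_points S0) mulnC.
  exists (enum_val \o cast_ord cardP \o enum_rank).
  apply: bij_comp (bij_comp (@enum_val_bij _) _) (@enum_rank_bij _).
  by exists (cast_ord (esym cardP)); [apply: cast_ordK | apply: cast_ordKV].
have f_inj := bij_inj f_bij; have [f' fK f'K] := f_bij.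
pose N : finType := (H * M + N0)%type.
pose I : finType := (R * I0 + outer_index)%type.
pose b (i : I) : {set cell} := match i with
  | inl (r, j) => setX [set r] (f @^-1: b0 j) | inr u => outer_block u end.
pose phi (i : I) : cell + N := match i with
  | inl (r, j) => match phi0 j with inl p => inl (r, f' p) | inr z => inr (inr z) end
  | inr u => if u.1.2.1 then inl (apex u) else inr (inl (u.1.2.2, u.2.1 - u.2.2)%R)
  end.
have in_inner r j x : (x \in b (inl (r, j))) = (x.1 == r) && (f x.2 \in b0 j).
  by case: x => x1 x2; rewrite /b in_setX !inE.
have phi_inner r j x : (phi (inl (r, j)) == inl x) = (x.1 == r) && (phi0 j == inl (f x.2)).
  case: x => x1 x2 /=; case: (phi0 j) => [p|z] /=; last by rewrite andbF.
  rewrite -[LHS]/((r == x1) && (f' p == x2)) -[in RHS]/(p == f x2) eq_sym.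
  by rewrite (can2_eq f'K fK).
have phi_outer u x : (phi (inr u) == inl x) = (signed_apex u == (x, true)).
  by rewrite /phi /signed_apex xpair_eqE; case: (u.1.2.1); rewrite ?andbT ?andbF.
exists cell, N, I, b, phi; split.
- rewrite /cell !card_prod card_ord cardM; by rewrite mulnA mulnC.
- rewrite /N card_sum card_prod cardM mulnDr (card_new S0) cardR; lia.
- rewrite /I /outer_index card_sum !card_prod card_bool card_ord (card_index S0) cardM cardR.
  case: (m) => [|k]; nia.
- case=> [[r j]|u]; last exact: card_outer_block.
  by rewrite /b cardsX cards1 mul1n on_card_preimset ?(card_block S0) //; apply: onW_bij.
- move=> x y xy; rewrite big_sumType /=.
  have := outer_pair xy.
  rewrite (eq_bigr (fun ri : R * I0 =>
    nat_of_bool ((x.1 == ri.1) && (f x.2 \in b0 ri.2)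
       && ((y.1 == ri.1) && (f y.2 \in b0 ri.2))))); last first.
    by case=> r j _; rewrite !in_inner.
  rewrite (sum_fiber (r0 := x.1)
    (F := fun r i => nat_of_bool ((x.1 == r) && (f x.2 \in b0 i)
      && ((y.1 == r) && (f y.2 \in b0 i)))));
    last by move=> r i; rewrite eq_sym => /negbTE->.
  rewrite eqxx (eq_sym y.1); case: (eqVneq x.1 y.1) => [x1|x1] /= outer; last first.
    by rewrite big1 // => i _; rewrite andbF.
  have f_xy : f x.2 != f y.2.
    by rewrite (inj_eq f_inj); apply: contraNneq xy; case: x y x1 {outer} => x1 x2 [y1 y2] /= -> ->.
  by apply: leq_trans (leq_add (pair_le2 S0 f_xy) outer).
- case=> [[r j]|u] x.
    move=> /eqP; rewrite phi_inner in_inner => /andP[_ /eqP/(notin_block S0)/negbTE->].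
    by rewrite andbF.
  move=> /eqP; rewrite phi_outer => /eqP[<- _].
  by rewrite /b !inE !negb_or !(eq_sym (apex u)) corner1_apex_neq corner2_apex_neq corner3_apex_neq.
- move=> x y xy.
  have inner a c : \sum_(ri : R * I0) ((phi (inl ri) == inl a) && (c \in b (inl ri))) =
      (a.1 == c.1) * \sum_j ((phi0 j == inl (f a.2)) && (f c.2 \in b0 j)).
    rewrite (eq_bigr (fun ri : R * I0 =>
      nat_of_bool ((a.1 == ri.1) && (phi0 ri.2 == inl (f a.2))
         && ((c.1 == ri.1) && (f c.2 \in b0 ri.2))))); last first.
      by case=> r j _; rewrite phi_inner in_inner.
    rewrite (sum_fiber (r0 := a.1)
      (F := fun r i => nat_of_bool ((a.1 == r) && (phi0 i == inl (f a.2))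
        && ((c.1 == r) && (f c.2 \in b0 i)))));
      last by move=> r i; rewrite eq_sym => /negbTE->.
    rewrite eqxx (eq_sym c.1); case: (a.1 == c.1); first by rewrite mul1n.
    by rewrite big1 // => i _; rewrite andbF.
  have outerE a c : \sum_u ((phi (inr u) == inl a) && (c \in b (inr u))) =
      \sum_u ((signed_apex u == (a, true)) && (c \in outer_block u)).
    by apply: eq_bigr => u _; rewrite phi_outer.
  rewrite !big_sumType !inner !outerE /=.
  have := outer_star xy.
  rewrite (eq_sym y.1); case: (eqVneq x.1 y.1) => [x1|x1] /= outer; last by rewrite !mul0n.
  have f_xy : f x.2 != f y.2.
    by rewrite (inj_eq f_inj); apply: contraNneq xy; case: x y x1 {outer} => x1 x2 [y1 y2] /= -> ->.
  by rewrite !mul1n addnACA; apply: leq_trans (leq_add (star_le1 S0 f_xy) outer).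
- move=> z x; rewrite big_sumType /=.
  case: z => [[h w]|z].
    rewrite big1 ?add0n; last by case=> r j _ /=; case: (phi0 j).
    apply: leq_trans (outer_new ((false, h), w) x).
    apply: leq_sum => u _; rewrite /tag_new /phi /b.
    by case: u => [[[r e] [[] k]] [u1 u2]].
  rewrite [X in _ + X]big1 ?addn0; last by move=> u _ /=; case: (u.1.2.1).
  rewrite (eq_bigr (fun ri : R * I0 =>
    nat_of_bool ((phi0 ri.2 == inr z) && ((x.1 == ri.1) && (f x.2 \in b0 ri.2))))); last first.
    by case=> r j _; rewrite in_inner /=; case: (phi0 j).
  rewrite (sum_fiber (r0 := x.1)
    (F := fun r i => nat_of_bool ((phi0 i == inr z) && ((x.1 == r) && (f x.2 \in b0 i)))));
    last by move=> r i; rewrite eq_sym => /negbTE->; rewrite andbF.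
  by rewrite eqxx; apply: (new_le3 S0).
Qed.
End Step.

(** * Double counting of ordered pairs *)

Lemma sum_pairs_in_set (T : finType) (X C : {set T}) :
  \sum_(x in X) \sum_(y in X | y != x) ((x \in C) && (y \in C))
  = #|C :&: X| * #|C :&: X|.-1.
Proof.
transitivity (\sum_(x in C :&: X) #|C :&: X|.-1); last by rewrite sum_nat_const.
rewrite big_mkcond [RHS]big_mkcond; apply: eq_bigr => x _; rewrite inE.
case xX: (x \in X); rewrite ?andbF //= andbT; case xC: (x \in C); last by rewrite big1.
rewrite (cardsD1 x) !inE xX xC /= -sum1_card big_mkcond [RHS]big_mkcond.
by apply: eq_bigr => y _; rewrite !inE; case: (y \in X); case: (y \in C); case: (y == x).
Qed.

(** The equality case is kept because it recovers every single pair count from the total. *)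
Lemma sum_pairs_const (T : finType) (X : {set T}) (F : T -> T -> nat) c :
  (forall x y, x \in X -> y \in X -> x != y -> F x y <= c) ->
  \sum_(x in X) \sum_(y in X | y != x) F x y <= #|X| * #|X|.-1 * c
    ?= iff [forall x in X, forall y in X, (y != x) ==> (F x y == c)].
Proof.
move=> Fc.
have -> : #|X| * #|X|.-1 * c = \sum_(x in X) \sum_(y in X | y != x) c.
  rewrite -mulnA -sum_nat_const; apply: eq_bigr => x xX.
  rewrite sum_nat_const; congr (_ * _); rewrite (cardsD1 x X) xX.
  by apply: eq_card => y; rewrite !inE andbC.
apply: leqif_sum => x xX.
have -> : [forall y in X, (y != x) ==> (F x y == c)] =
  [forall (y | (y \in X) && (y != x)), F x y == c].
  by apply: eq_forallb => y; case: (y \in X); case: (y == x).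
apply: leqif_sum => y /andP[yX yx]; split=> //.
by apply: Fc; rewrite // eq_sym.
Qed.

(** Each block holds 6 ordered pairs, and 6m(3m - 1) is exactly twice the number 3m(3m - 1) of
    ordered pairs of points. *)
Lemma nested_pair_eq2 m (P N I : finType) (b : I -> {set P}) (phi : I -> P + N) :
  nested_system m b phi ->
  forall x y, x != y -> \sum_i ((x \in b i) && (y \in b i)) = 2.
Proof.
move=> S.
have [_] := @sum_pairs_const P [set: P] _ 2 (fun x y _ _ xy => pair_le2 S xy).
have -> : \sum_(x in [set: P]) \sum_(y in [set: P] | y != x)
     \sum_i ((x \in b i) && (y \in b i)) = #|[set: P]| * #|[set: P]|.-1 * 2.
  transitivity (\sum_i \sum_(x in [set: P]) \sum_(y in [set: P] | y != x)
     ((x \in b i) && (y \in b i))).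
    under eq_bigr => x _ do rewrite exchange_big /=.
    by rewrite exchange_big.
  under eq_bigr => i _ do rewrite sum_pairs_in_set setIT (card_block S).
  by rewrite sum_nat_const (card_index S) cardsT (card_points S); lia.
rewrite eqxx => /esym/forall_inP E x y xy.
by have /forall_inP/(_ y (in_setT _)) := E x (in_setT _); rewrite eq_sym xy => /eqP.
Qed.

(** * The system on three points *)

(** The full block taken twice, both times nested with the single new point. *)
Lemma nested_system1 : has_nested_system 1.
Proof.
exists 'I_3, unit, bool, (fun=> setT), (fun=> inr tt); split=> //.
- by rewrite card_ord.
- by rewrite card_unit.
- by rewrite card_bool.
- by move=> _; rewrite cardsT card_ord.
- by move=> x y _; rewrite big_bool !inE.
- by move=> x y _; rewrite !big_bool.
- by move=> [] x; rewrite big_bool inE.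
Qed.

(** * From nested systems to weak nestings *)

Lemma nested_blocks_codom (T I : finType) (B : I -> {set T}) (p : I -> T) :
  exists phi : 'I_(size [seq B i | i <- enum I]) -> T,
    (forall j : 'I_(size [seq B i | i <- enum I]), exists i,
      nth set0 [seq B i | i <- enum I] j = B i /\ phi j = p i) /\
    nested_blocks [seq B i | i <- enum I] phi = [seq p i |: B i | i <- enum I].
Proof.
set A := [seq B i | i <- enum I].
have sz : size A = size (enum I) by rewrite size_map.
(* A general [n] lets [subst] remove the cast in [idx_enum]. *)
pose idx n (e : n = size (enum I)) j := tnth (in_tuple (enum I)) (cast_ord e j).
have idx_enum n e : [seq @idx n e j | j <- enum 'I_n] = enum I.
  rewrite -[RHS](map_tnth_enum (in_tuple (enum I))) /idx; subst n.
  by apply: eq_map => j; rewrite cast_ord_id.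
have nthA (j : 'I_(size A)) : nth set0 A j = B (idx _ sz j).
  rewrite /idx (tnth_nth (idx _ sz j)) /= (nth_map (idx _ sz j)) //.
  by rewrite -sz.
exists (fun j => p (idx _ sz j)); split; first by move=> j; exists (idx _ sz j).
rewrite -[in RHS](idx_enum _ sz) -map_comp; apply: eq_map => j /=.
by rewrite nthA.
Qed.

Lemma count_map_enum (I T : finType) (B : I -> {set T}) (Q : pred {set T}) :
  count Q [seq B i | i <- enum I] = \sum_i Q (B i).
Proof.
rewrite count_map -sum1_count big_enum_cond /= big_mkcond.
by apply: eq_bigr => i _; case: ifP.
Qed.

Lemma weak_nesting_of_nested_system m : has_nested_system m ->
  exists (T : finType) (X Y : {set T}) (A : seq {set T}) (phi : 'I_(size A) -> T),
    is_BIBD X (3 * m) 3 2 A /\ weak_nesting X Y (3 * m + m.+1./2) 3 2 A phi.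
Proof.
move=> [P [N [I [b [p S]]]]]; pose T : finType := (P + N)%type.
have inl_inj : injective (@inl P N) by move=> x y [].
have [phi [phiE nestE]] := nested_blocks_codom (fun i => inl @: b i : {set T}) p.
exists T, [set inl x | x in P], setT, _, phi.
have mem_l x i : (inl x \in (inl @: b i : {set T})) = (x \in b i) by rewrite mem_imset.
have mem_r z i : (inr z \in (inl @: b i : {set T})) = false.
  by apply/imsetP=> -[].
split.
  split; first by rewrite card_imset // (card_points S).
  - move=> _ /mapP[i _ ->]; rewrite card_imset // (card_block S); split=> //.
    by apply: imsetS; apply/subsetP.
  - move=> _ _ /imsetP[x _ ->] /imsetP[y _ ->] xy; rewrite count_map_enum.
    by under eq_bigr => i _ do rewrite !mem_l; apply: (nested_pair_eq2 S).
have notin i : p i \notin (inl @: b i : {set T}).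
  by case E: (p i) => [x|z]; rewrite ?mem_r // mem_l (notin_block S E).
split; rewrite ?subsetT //.
  by move=> j; have [i [-> ->]] := phiE j.
rewrite nestE; split.
- rewrite cardsT card_sum (card_points S) -(card_new S) mul2n doubleK //.
- move=> _ /mapP[i _ ->]; rewrite subsetT cardsU1 notin card_imset // (card_block S) //.
- move=> x y _ _ xy; rewrite count_map_enum.
  case: x y xy => [x|z] [y|z'] xy; under eq_bigr => i _ do rewrite !inE ?mem_l ?mem_r.
  + have {}xy : x != y by [].
    (* Two blocks contain the pair already; at most one more acquires it through its nested
       point. *)
    apply: leq_trans (leq_add (eq_leq (nested_pair_eq2 S xy)) (star_le1 S xy)).
    rewrite -!big_split /=; apply: leq_sum => i _; rewrite !(eq_sym _ (p i)).
    have : ~~ ((p i == inl x) && (p i == inl y)).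
      by apply/negP=> /andP[/eqP-> /eqP[E]]; rewrite E eqxx in xy.
    by move: (x \in b i) (y \in b i) (p i == _) (p i == _) => [] [] [] [].
  + apply: leq_trans (new_le3 S z' x); apply: leq_sum => i _.
    rewrite orbF !(eq_sym _ (p i)).
    by case: (eqVneq (p i) (inr z')) => [->|_] /=; rewrite ?andbF ?andbT.
  + apply: leq_trans (new_le3 S z y); apply: leq_sum => i _.
    rewrite orbF !(eq_sym _ (p i)).
    by case: (eqVneq (p i) (inr z)) => [->|_].
  (* A block receives a single point, so two new points never meet. *)
  + rewrite big1 // => i _; rewrite !orbF.
    rewrite !(eq_sym _ (p i)); case: (eqVneq (p i) (inr z)) => [->|_] //=.
    by rewrite (negbTE xy).
Qed.

(** * The lower bound *)

Lemma weak_nesting_lower_bound (T : finType) (X Y : {set T}) (A : seq {set T})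
    (phi : 'I_(size A) -> T) v w :
  is_BIBD X v 3 2 A -> weak_nesting X Y w 3 2 A phi -> 0 < v -> v.-1 <= 6 * (w - v).
Proof.
case=> cardX blockA pairA [XY phiY phiN [cardY blockN pairN]] v0.
pose B (i : 'I_(size A)) := nth set0 A i.
have BA i : B i \in A by rewrite mem_nth.
have BX i : B i :&: X = B i by apply/setIidPl; case: (blockA _ (BA i)).
have cB i : #|B i| = 3 by case: (blockA _ (BA i)).
have countA (Q : pred {set T}) : count Q A = \sum_i Q (B i).
  rewrite -sum1_count big_mkcond (big_nth set0) big_mkord.
  by apply: eq_bigr => i _; case: ifP.
have countN (Q : pred {set T}) : count Q (nested_blocks A phi) = \sum_i Q (phi i |: B i).
  by rewrite count_map_enum.
pose D := \sum_i (phi i \in X); pose E := \sum_i (phi i \notin X).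
have DE : D + E = size A.
  rewrite -big_split /= -[RHS]card_ord -sum1_card; apply: eq_bigr => i _.
  by case: (_ \in _).
have sizeA : 6 * size A = v * v.-1 * 2.
  have pairs x y : x \in X -> y \in X -> x != y ->
      \sum_i ((x \in B i) && (y \in B i)) = 2.
    by move=> xX yX xy; rewrite -(pairA x y) // countA.
  transitivity (\sum_(x in X) \sum_(y in X | y != x) \sum_i ((x \in B i) && (y \in B i))).
    under [RHS]eq_bigr => x _ do rewrite exchange_big /=.
    rewrite exchange_big /=.
    under [RHS]eq_bigr => i _ do rewrite sum_pairs_in_set BX cB.
    by rewrite sum_nat_const card_ord mulnC.
  have pairs_le x y : x \in X -> y \in X -> x != y ->
      \sum_i ((x \in B i) && (y \in B i)) <= 2.
    by move=> xX yX xy; rewrite pairs.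
  apply/eqP; rewrite -cardX (sum_pairs_const pairs_le).
  apply/forall_inP=> x xX; apply/forall_inP=> y yX; apply/implyP=> yx.
  by rewrite pairs // eq_sym.
(* Ordered pairs inside [X]: 4 * 3 from a block nested in [X], 3 * 2 from any other. *)
have inner : 12 * D + 6 * E <= v * v.-1 * 3.
  have pairs x y : x \in X -> y \in X -> x != y ->
      \sum_i ((x \in phi i |: B i) && (y \in phi i |: B i)) <= 3.
    move=> xX yX xy; rewrite -(countN (fun C => (x \in C) && (y \in C))).
    by apply: pairN; rewrite ?(subsetP XY).
  rewrite -cardX; have [le_pairs _] := sum_pairs_const pairs; apply: leq_trans le_pairs.
  under [leqRHS]eq_bigr => x _ do rewrite exchange_big /=.
  rewrite exchange_big /= !big_distrr -big_split /=; apply: leq_sum => i _.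
  rewrite sum_pairs_in_set setIUl BX; case: (boolP (phi i \in X)) => iX.
    have -> : [set phi i] :&: X = [set phi i] by apply/setIidPl; rewrite sub1set.
    by rewrite cardsU1 cB phiN.
  have -> : [set phi i] :&: X = set0.
    apply/setP=> x; rewrite !inE; case: eqP => // ->; exact/negbTE.
  by rewrite set0U cB.
(* Pairs of a point of [X] with a point outside: each block nested outside [X] gives three. *)
have outer : 3 * E <= v * (w - v) * 3.
  have cYX : #|Y :\: X| = w - v by rewrite cardsD (setIidPr XY) cardY cardX.
  rewrite -cYX -cardX -mulnA -sum_nat_const.
  have le3 x : x \in X -> \sum_(y in Y :\: X)
      \sum_i ((x \in phi i |: B i) && (y \in phi i |: B i)) <= #|Y :\: X| * 3.
    move=> xX; rewrite -sum_nat_const; apply: leq_sum => y; rewrite inE => /andP[yX yY].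
    rewrite -(countN (fun C => (x \in C) && (y \in C))).
    apply: pairN => //; first exact: (subsetP XY).
    by apply: contraNneq yX => <-.
  apply: (@leq_trans (\sum_(x in X) \sum_(y in Y :\: X)
      \sum_i ((x \in phi i |: B i) && (y \in phi i |: B i)))); last exact: leq_sum.
  under [leqRHS]eq_bigr => x _ do rewrite exchange_big /=.
  rewrite exchange_big big_distrr; apply: leq_sum => i _ /=.
  case: (boolP (phi i \in X)) => //= iX; rewrite muln1 -(cB i) -BX -sum1_card.
  rewrite big_mkcond [leqRHS]big_mkcond; apply: leq_sum => x _; rewrite !inE.
  case: (boolP (x \in B i)) => //= xB; case: (x \in X) => //=.
  by rewrite (bigD1 (phi i)) /= ?inE ?eqxx ?orbT ?iX ?phiY.
case: v {cardX} v0 sizeA inner outer => // v _ sizeA inner outer.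
(* Twice [sizeA] minus [inner] bounds 6E from below, and [outer] bounds it from above. *)
have : v.+1 * v <= v.+1 * (6 * (w - v.+1)) by nia.
by rewrite leq_pmul2l.
Qed.

(** * The system on nine points *)

(* Two copies of the affine plane of order 3 on the points 3a + b < 9, with
   new points 9 and 10; each block is paired with the point nested with it. *)
Definition point9 a b := 3 * (a %% 3) + b %% 3.

(** Mixed triples of Bose's construction over Z/3: b is the level and a is the mean of a + 1 and a +
    2. The remaining triples have constant a. *)
Definition line9 a b := [:: point9 a.+1 b; point9 a.+2 b; point9 a b.+1].

Definition nesting9 : seq (seq nat * nat) :=
  [seq (line9 a b, point9 a.+1 b.+1) | a <- iota 0 3, b <- iota 0 3]
  ++ [seq (line9 a b, 9) | a <- iota 0 3, b <- iota 0 3]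
  ++ [seq ([:: point9 a 0; point9 a 1; point9 a 2], 10) | a <- iota 0 3 ++ iota 0 3].

(** Moves sums to lists of numbers, which [vm_compute] evaluates; 24 = 3 * 8 is the required number
    of blocks. *)
Lemma sum_nesting9 (F : seq nat * nat -> nat) :
  \sum_(i < 24) F (nth ([::], 0) nesting9 i) = sumn (map F nesting9).
Proof. by rewrite sumnE big_map [RHS](big_nth ([::], 0)) big_mkord. Qed.

Lemma nested_system3 : has_nested_system 3.
Proof.
pose blk (i : 'I_24) := nth ([::], 0) nesting9 i.
pose b i : {set 'I_9} := [set x | nat_of_ord x \in (blk i).1].
pose phi i : 'I_9 + 'I_2 :=
  if (blk i).2 < 9 then inl (inord (blk i).2) else inr (inord ((blk i).2 - 9)).
have all9 (Q : pred (seq nat * nat)) : all Q nesting9 -> forall i, Q (blk i).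
  by move=> /allP Qall i; apply/Qall/mem_nth.
have phi_lt i : (blk i).2 < 11 by apply: (all9 (fun l => l.2 < 11)).
have phi_l i x : (phi i == inl x) = ((blk i).2 == x).
  rewrite /phi; case: ltnP => [lt9|ge9].
    by rewrite -[LHS]/(inord (blk i).2 == x) -val_eqE /= inordK.
  by symmetry; apply/eqP => E; move: ge9; rewrite E leqNgt ltn_ord.
have phi_r i z : (phi i == inr z) = ((blk i).2 == 9 + z).
  rewrite /phi; case: ltnP => [lt9|ge9].
    by symmetry; apply/eqP => E; move: lt9; rewrite E ltnNge leq_addr.
  have := phi_lt i => lt11.
  rewrite -[LHS]/(inord ((blk i).2 - 9) == z) -val_eqE /= inordK; lia.
exists 'I_9, 'I_2, 'I_24, b, phi; split; rewrite ?card_ord //.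
- move=> i; rewrite -sum1_card big_mkcond.
  under eq_bigr => x _ do rewrite inE.
  rewrite -(big_mkord xpredT (fun k => if k \in (blk i).1 then 1 else 0)).
  rewrite -[index_iota 0 9]/(iota 0 9) -(big_map _ xpredT id) -sumnE.
  apply/eqP; apply: (all9 (fun l => sumn [seq if k \in l.1 then 1 else 0 | k <- iota 0 9] == 3)).
  by vm_compute.
- move=> x y xy; under eq_bigr => i _ do rewrite !inE.
  rewrite (sum_nesting9 (fun l => (nat_of_ord x \in l.1) && (nat_of_ord y \in l.1))).
  have /allP/(_ (nat_of_ord x))/(_ _)/allP/(_ (nat_of_ord y)) :
    all (fun x => all (fun y => (x != y) ==>
     (sumn [seq nat_of_bool ((x \in l.1) && (y \in l.1)) | l <- nesting9] <= 2)) (iota 0 9)) (iota 0 9)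
    by vm_compute.
  by rewrite !mem_iota !ltn_ord => /(_ isT isT) /implyP; apply.
- move=> i x /eqP; rewrite phi_l inE => /eqP <-.
  by apply: (all9 (fun l => l.2 \notin l.1)); vm_compute.
- move=> x y xy.
  under eq_bigr => i _ do rewrite phi_l inE.
  under [X in _ + X <= _]eq_bigr => i _ do rewrite phi_l inE.
  rewrite (sum_nesting9 (fun l => (l.2 == nat_of_ord x) && (nat_of_ord y \in l.1))).
  rewrite (sum_nesting9 (fun l => (l.2 == nat_of_ord y) && (nat_of_ord x \in l.1))).
  have /allP/(_ (nat_of_ord x))/(_ _)/allP/(_ (nat_of_ord y)) :
    all (fun x => all (fun y => (x != y) ==>
     (sumn [seq nat_of_bool ((l.2 == x) && (y \in l.1)) | l <- nesting9]
      + sumn [seq nat_of_bool ((l.2 == y) && (x \in l.1)) | l <- nesting9] <= 1)) (iota 0 9)) (iota 0 9)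
    by vm_compute.
  by rewrite !mem_iota !ltn_ord => /(_ isT isT) /implyP; apply.
- move=> z x.
  under eq_bigr => i _ do rewrite phi_r inE.
  rewrite (sum_nesting9 (fun l => (l.2 == 9 + z) && (nat_of_ord x \in l.1))).
  have /allP/(_ (nat_of_ord z))/(_ _)/allP/(_ (nat_of_ord x)) :
    all (fun z => all (fun x =>
     (sumn [seq nat_of_bool ((l.2 == 9 + z) && (x \in l.1)) | l <- nesting9] <= 3)) (iota 0 9)) (iota 0 2)
    by vm_compute.
  by rewrite !mem_iota !ltn_ord => /(_ isT isT).
Qed.

(** * Choices of the group and of the odd map *)

Lemma nested_system_mul (R : finZmodType) (H : finType) (K : R -> R) (g : H -> R) m :
  {morph K : i / - i}%R -> injective K ->
  injective (fun i => K i + i)%R -> injective (fun i => K i - i)%R ->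
  injective g -> (forall h k, g h <> - g k)%R -> #|R| = (2 * #|H|).+1 ->
  odd m -> has_nested_system m -> has_nested_system (#|R| * m).
Proof.
move=> KN K_inj KD_inj KB_inj g_inj gN cardR m_odd Sm.
(* Z/m serves as [M]; the successor form carries the group structure. *)
have cardM : #|'I_m.-1.+1| = m by rewrite card_ord prednK // odd_gt0.
apply: (nested_step (M := 'I_m.-1.+1) KN K_inj KD_inj KB_inj _ _ g_inj gN) => //.
  by apply: mulrn_coprime_inj; rewrite coprime2n cardR /= mul2n odd_double.
by apply: mulrn_coprime_inj; rewrite coprime2n cardM.
Qed.

(** [K] is a quarter turn, so K^2 = -1 and (1 + K)(1 - K) = 2, which is invertible modulo 3. No
    multiplier on Z/3 would do, since one of c, c + 1, c - 1 vanishes there. *)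
Lemma nested_system_mul9 m : odd m -> has_nested_system m -> has_nested_system (9 * m).
Proof.
move=> m_odd.
have F2 : injective (fun x : 'I_3 => x *+ 2)%R by apply: mulrn_coprime_inj; rewrite card_ord.
pose R : finZmodType := 'rV['I_3]_2.
pose pr (a b : 'I_3) : R := (\row_j if j == 0 then a else b)%R.
pose x1 (u : R) : 'I_3 := u ord0 ord0; pose x2 (u : R) : 'I_3 := u ord0 ord_max.
have pr1 a b : x1 (pr a b) = a by rewrite /x1 mxE.
have pr2 a b : x2 (pr a b) = b by rewrite /x2 mxE.
have R_inj u v : x1 u = x1 v -> x2 u = x2 v -> u = v.
  move=> E1 E2; apply/rowP=> -[[|[|]]] // lt; [move: E1 | move: E2];
    by congr (_ = _); congr fun_of_matrix; apply: val_inj.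
have D1 u v : x1 (u + v)%R = (x1 u + x1 v)%R by rewrite /x1 mxE.
have D2 u v : x2 (u + v)%R = (x2 u + x2 v)%R by rewrite /x2 mxE.
have N1 u : x1 (- u)%R = (- x1 u)%R by rewrite /x1 mxE.
have N2 u : x2 (- u)%R = (- x2 u)%R by rewrite /x2 mxE.
have <- : #|R| = 9 by rewrite card_mx card_ord.
pose K (u : R) : R := pr (- x2 u)%R (x1 u).
(* Representatives up to sign: the first nonzero coordinate is 1. *)
pose g (h : option 'I_3) : R := if h is Some c then pr 1%R c else pr 0%R 1%R.
apply: (@nested_system_mul R (option 'I_3) K g) => //.
- by move=> u; apply: R_inj; rewrite ?N1 ?N2 !(pr1, pr2) ?N1 ?N2.
- move=> u v E; apply: R_inj.
    by have := congr1 x2 E; rewrite !pr2.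
  by have := congr1 x1 E; rewrite !pr1 => /oppr_inj.
- move=> u v E; have := congr1 x1 E; have := congr1 x2 E.
  rewrite !(D1, D2) !(pr1, pr2) !(addrC (- _))%R => E1 E2.
  have [] : (x1 u, x2 u) = (x1 v, x2 v) by apply: (sub_add_inj F2); congr pair.
  exact: R_inj.
- move=> u v E; have := congr1 x1 E; have := congr1 x2 E.
  rewrite !(D1, D2) !(N1, N2) !(pr1, pr2) -!opprD => E1 /oppr_inj; rewrite addrC [RHS]addrC => E2.
  have [] : (x1 u, x2 u) = (x1 v, x2 v) by apply: (sub_add_inj F2); congr pair.
  exact: R_inj.
- move=> [c|] [d|] E; have := congr1 x1 E; have := congr1 x2 E; rewrite ?pr1 ?pr2 //.
  by move->.
- by move=> [c|] [d|] E; have := congr1 x1 E; have := congr1 x2 E; rewrite ?N1 ?N2 ?pr1 ?pr2.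
- by rewrite card_mx card_option !card_ord.
Qed.

(** With [K] doubling, K + 1 and K - 1 are multiplication by 3 and by 1. *)
Lemma nested_system_mul_coprime6 q m : odd q -> coprime 3 q -> odd m ->
  has_nested_system m -> has_nested_system (q * m).
Proof.
case: q => // q q_odd q3 m_odd Sm.
suff: has_nested_system (#|'I_q.+1| * m) by rewrite card_ord.
have inj3 : injective (fun x : 'I_q.+1 => x *+ 3)%R.
  by apply: mulrn_coprime_inj; rewrite card_ord.
have inj2 : injective (fun x : 'I_q.+1 => x *+ 2)%R.
  by apply: mulrn_coprime_inj; rewrite card_ord coprime2n.
pose g (h : 'I_(q.+1)./2) : 'I_q.+1 := inord h.+1.
have gE h : val (g h) = h.+1.
  by rewrite /= inordK // ltnS; have := ltn_ord h; lia.
apply: (@nested_system_mul _ _ (fun x => x *+ 2)%R g) => //.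
- by move=> x; rewrite mulNrn.
- by move=> x y; rewrite -!mulrSr => /inj3.
- by move=> x y; rewrite !mulr2n !addrK.
- by move=> h k /(congr1 val); rewrite !gE => -[] /val_inj.
(* Two representatives have a sum strictly between 0 and the modulus. *)
- move=> h k /(congr1 (fun x => val (x + g k)%R)); rewrite addNr /= !gE.
  have := ltn_ord h; have := ltn_ord k => kq hq.
  by rewrite modn_small; lia.
- by rewrite !card_ord; lia.
Qed.

(** * All odd m, and the theorem *)

Lemma nested_system_odd m : odd m -> has_nested_system m.
Proof.
move=> m_odd.
(* Multiplication by 9 skips every other power of 3, so two consecutive powers are carried along. *)
have S3 a : has_nested_system (3 ^ a) /\ has_nested_system (3 ^ a.+1).
  elim: a => [|a [IH IH1]]; first by split; [apply: nested_system1|apply: nested_system3].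
  split=> //; rewrite !expnS mulnA; apply: nested_system_mul9 => //.
  by rewrite oddX orbT.
have [q q3 mE] := pfactor_coprime (isT : prime 3) (odd_gt0 m_odd).
have q_odd : odd q by move: m_odd; rewrite mE oddM => /andP[].
rewrite mE.
apply: nested_system_mul_coprime6 => //; first by rewrite oddX orbT.
exact: (S3 _).1.
Qed.

Theorem theorem3p3 (v : nat) :
  v %% 6 = 3 -> 9 <= v ->
  (exists (T : finType) (X Y : {set T}) (A : seq {set T})
          (phi : 'I_(size A) -> T),
      is_BIBD X v 3 2 A /\ weak_nesting X Y ((7 * v + 3) %/ 6) 3 2 A phi)
  /\
  (forall (T : finType) (X Y : {set T}) (A : seq {set T})
          (phi : 'I_(size A) -> T) (w : nat),
      is_BIBD X v 3 2 A -> weak_nesting X Y w 3 2 A phi ->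
      (7 * v + 3) %/ 6 <= w).
Proof.
move=> v3 v9; split=> [|T X Y A phi w BA WA]; last first.
  (* The bound reads 6w >= 7v - 1; as 7v is 3 modulo 6, this rounds up to 6w >= 7v + 3. *)
  have := weak_nesting_lower_bound BA WA; lia.
have m_odd : odd (v %/ 3) by lia.
have := weak_nesting_of_nested_system (nested_system_odd m_odd).
have -> : 3 * (v %/ 3) = v by lia.
by have -> : v + (v %/ 3).+1./2 = (7 * v + 3) %/ 6 by lia.
Qed.
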